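(* Let $(G,+)$ be a (not necessarily abelian) group. If $N\unlhd G$ is such that $G/N$ is abelian and $\mathcal{S}$ is a set of representatives of $G/N$ that is a subgroup of $G$, then any map $\mathfrak{R}:G\to G$ such that $\operatorname{Im}\mathfrak{R}=\mathcal{S}$ and $\mathfrak{R}(g)\in N+g$, for every $g\in G$, is an idempotent Rota--Baxter endomorphism of $G$. Conversely, if $\mathfrak{R}$ is an idempotent Rota--Baxter endomorphism of $G$, then $G/\ker\mathfrak{R}$ is abelian, $\operatorname{Im}\mathfrak{R}$ is a subgroup of $G$ that is also a set of representatives of $G/\ker\mathfrak{R}$, and $\mathfrak{R}(g)\in\ker\mathfrak{R}+g$, for every $g\in G$.
   Context: A Rota--Baxter operator on a group $(G,+)$ is a map $\mathfrak{R}:G\to G$ such that $\mathfrak{R}(a)+\mathfrak{R}(b)=\mathfrak{R}(a+\mathfrak{R}(a)+b-\mathfrak{R}(a))$ for all $a,b\in G$. A Rota--Baxter endomorphism of $G$ is a group endomorphism of $G$ that is a Rota--Baxter operator; it is idempotent if $\mathfrak{R}^2=\mathfrak{R}$. A set of representatives of $G/N$ is a subset of $G$ containing exactly one element of each coset of $N$. *)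

(* Defs.v *)
From mathcomp Require Import all_boot.
From mathcomp Require Import boolp classical_sets.

Set Implicit Arguments.
Unset Strict Implicit.
Unset Printing Implicit Defensive.

Local Open Scope classical_set_scope.
Local Open Scope group_scope.

(* Groups are written multiplicatively and need be neither finite nor
   abelian: [x * y] stands for x + y, [x^-1] for -x and [1] for 0. *)

Definition is_subgroup (G : groupType) (H : set G) : Prop :=
  group_closed (mem H).

Definition is_normal_subgroup (G : groupType) (N : set G) : Prop :=
  is_subgroup N /\ forall n g : G, N n -> N (n ^ g).

Definition coset (G : groupType) (N : set G) (g : G) : set G :=
  [set n * g | n in N].

(* The underlying set of G/N. *)
Definition cosets (G : groupType) (N : set G) : set (set G) :=
  range (coset N).

(* Elementwise product; it is the group law of G/N when N is normal, see
   [coset_mulE]. *)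
Definition coset_mul (G : groupType) (A B : set G) : set G :=
  [set x * y | x in A & y in B].

Lemma coset_mulE (G : groupType) (N : set G) (a b : G) :
  is_normal_subgroup N ->
  coset_mul (coset N a) (coset N b) = coset N (a * b).
Proof.
move=> [Nsub NJ]; have [N1 _] := Nsub.
have NM (x y : G) : N x -> N y -> N (x * y).
  move=> Nx Ny; have := group_closedM Nsub.
  by move=> /(_ x y); rewrite !inE; apply.
apply/seteqP; split=> z.
  case=> _ [n Nn <-] [_ [m Nm <-] <-].
  exists (n * (m ^ a^-1)); first by apply: NM => //; apply: NJ.
  by rewrite /conjg invgK !mulgA mulgVK.
case=> n Nn <-; exists (n * a); first by exists n.
exists b; last by rewrite mulgA.
by exists 1; [rewrite !inE in N1 | rewrite mul1g].
Qed.

Definition abelian_quotient (G : groupType) (N : set G) : Prop :=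
  {in cosets N &, commutative (@coset_mul G)}.

Definition is_representatives (G : groupType) (N S : set G) : Prop :=
  forall C : set G, cosets N C -> exists! s : G, (S `&` C) s.

Definition kernel (G : groupType) (f : G -> G) : set G := f @^-1` [set 1].

Definition rota_baxter (G : groupType) (R : G -> G) : Prop :=
  forall a b : G, R a * R b = R (a * R a * b * (R a)^-1).

Definition rota_baxter_endomorphism (G : groupType) (R : G -> G) : Prop :=
  {morph R : x y / x * y} /\ rota_baxter R.

Definition idempotent_rota_baxter_endomorphism
    (G : groupType) (R : G -> G) : Prop :=
  rota_baxter_endomorphism R /\ idempotent_fun R.

(* Main.v *)
Require Import Defs.
From mathcomp Require Import all_boot.
From mathcomp Require Import boolp classical_sets.

Local Open Scope classical_set_scope.
Local Open Scope group_scope.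

(** An idempotent endomorphism is the projection onto a complement of its
    kernel. For an idempotent endomorphism R, the Rota-Baxter identity at (a, b)
    reads R a R b = R a R a R b (R a)^-1, i.e. R a and R b commute, and this
    says exactly that the image of R, isomorphic to G / ker R, is abelian. *)

Lemma is_subgroupP (G : groupType) (H : set G) :
  is_subgroup H <-> H 1 /\ forall x y : G, H x -> H y -> H (x / y).
Proof.
split=> [[H1 Hdiv] | [H1 Hdiv]].
  split=> [|x y Hx Hy]; first by rewrite inE in H1.
  by have := Hdiv x y; rewrite !inE; apply.
by split=> [|x y]; rewrite !inE //; apply: Hdiv.
Qed.

Lemma cosetP (G : groupType) (N : set G) (g x : G) :
  coset N g x <-> N (x / g).
Proof.
split=> [[n Nn <-] | Nxg]; first by rewrite mulgK.
by exists (x / g) => //; rewrite mulgVK.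
Qed.

Lemma coset_refl (G : groupType) (N : set G) (g : G) :
  is_normal_subgroup N -> coset N g g.
Proof. by move=> [/is_subgroupP[N1 _] _]; apply/cosetP; rewrite mulgV. Qed.

(** By [coset_mulE], commutation of cosets can be tested on representatives, so products of sets
    disappear from the later arguments. *)
Lemma abelian_quotientP (G : groupType) (N : set G) :
  is_normal_subgroup N ->
  abelian_quotient N <-> forall a b : G, coset N (a * b) = coset N (b * a).
Proof.
move=> Nnormal; split=> [Nab a b | Nab A B].
  by rewrite -!coset_mulE //; apply: Nab; rewrite inE; [exists a | exists b].
by rewrite !inE => -[a _ <-] [b _ <-]; rewrite !coset_mulE.
Qed.

Section Morphism.
Context {G : groupType} {R : G -> G}.
Hypothesis RM : {morph R : x y / x * y}.

Lemma morphM1 : R 1 = 1.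
Proof. by apply: (@mulIg _ (R 1)); rewrite -RM !mul1g. Qed.

Lemma morphM_div : {morph R : x y / x / y}.
Proof.
by move=> x y; apply: (@mulIg _ (R y)); rewrite -RM !mulgVK.
Qed.

Lemma kernel_normal : is_normal_subgroup (kernel R).
Proof.
split=> [|n g Rn1].
  apply/is_subgroupP; split=> [|x y Rx1 Ry1]; first exact: morphM1.
  by rewrite /kernel /= morphM_div Rx1 Ry1 divgg.
by rewrite /kernel /= conjgE !RM Rn1 mul1g -RM mulVg morphM1.
Qed.

Lemma range_subgroup : is_subgroup (range R).
Proof.
apply/is_subgroupP; split=> [|_ _ [x _ <-] [y _ <-]].
  by exists 1; rewrite ?morphM1.
by exists (x / y); rewrite ?morphM_div.
Qed.

(** Since [R (x / g) = R x / R g], cosets of the kernel are fibres of [R]; in the converse, every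
    claim about cosets thus becomes an equation between values of [R]. *)
Lemma coset_kernelE (g : G) : coset (kernel R) g = [set x | R x = R g].
Proof.
apply/seteqP; split=> x; rewrite /= cosetP /kernel /= morphM_div.
  by move/divg1_eq.
by move=> ->; rewrite divgg.
Qed.

Lemma rota_baxter_commute :
  idempotent_fun R ->
  rota_baxter R <-> forall a b : G, commute (R a) (R b).
Proof.
move=> Ridem; have RR g : R (R g) = R g by exact: Ridem.
have E a b : R (a * R a * b * (R a)^-1) = R a * (R a * R b / R a).
  by rewrite morphM_div !RM !RR !mulgA.
split=> [RB a b | Rcomm a b]; last by rewrite E (Rcomm a b) mulgK Rcomm.
(* Cancelling [R a] on the left leaves [R b = R a * R b / R a]: conjugation by [R a] fixes [R b]. *)
have /mulgI RbE := etrans (RB a b) (E a b).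
by rewrite /commute [in RHS]RbE mulgVK.
Qed.

End Morphism.

Section RepresentativeMap.
Context {G : groupType} {N S : set G} {R : G -> G}.
Hypotheses (Nnormal : is_normal_subgroup N) (Nab : abelian_quotient N).
Hypotheses (Srepr : is_representatives N S) (Ssub : is_subgroup S).
Hypotheses (RS : forall g : G, S (R g)).
Hypothesis (RN : forall g : G, coset N g (R g)).

(** [R g] and [s] both lie in [S] and in the coset of [g], which share a single point. Each identity
    about [R] below reduces to these two memberships for a suitable [s]. *)
Lemma representative_unique (g s : G) : S s -> coset N g s -> R g = s.
Proof.
move=> Ss Ngs; have [] := Srepr (coset N g); first by exists g.
by move=> r [_ r_uniq]; rewrite -(r_uniq s) // -(r_uniq (R g)).
Qed.

(** The candidate is [R x * R y]: it is in [S] because [S] is closed under products, and in the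
    coset of [x * y] because cosets multiply. *)
Lemma representative_morph : {morph R : x y / x * y}.
Proof.
move=> x y; apply: representative_unique.
  by have /(_ (R x) (R y)) := group_closedM Ssub; rewrite !inE; apply.
by rewrite -coset_mulE //; exists (R x) => //; exists (R y).
Qed.

Lemma representative_idempotent : idempotent_fun R.
Proof.
by move=> g; apply: representative_unique => //; exact: coset_refl.
Qed.

(** As [a * b] and [b * a] have the same coset, [R (b * a)] is also the representative of
    [a * b]. *)
Lemma representative_commute (a b : G) : commute (R a) (R b).
Proof.
rewrite /commute -!representative_morph; apply: representative_unique => //.
by have /abelian_quotientP-> := Nab.
Qed.

End RepresentativeMap.

Theorem theorem14 (G : groupType) :
  (forall (N S : set G) (R : G -> G),
      is_normal_subgroup N ->
      abelian_quotient N ->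
      is_representatives N S ->
      is_subgroup S ->
      range R = S ->
      (forall g : G, coset N g (R g)) ->
      idempotent_rota_baxter_endomorphism R) /\
  (forall R : G -> G,
      idempotent_rota_baxter_endomorphism R ->
      [/\ is_normal_subgroup (kernel R) /\ abelian_quotient (kernel R),
          is_subgroup (range R),
          is_representatives (kernel R) (range R)
        & forall g : G, coset (kernel R) g (R g)]).
Proof.
split=> [N S R Nnormal Nab Srepr Ssub rangeR RN | R [[RM RB] Ridem]].
  have RS g : S (R g) by rewrite -rangeR; exists g.
  have RM := representative_morph Nnormal Srepr Ssub RS RN.
  have Ridem := representative_idempotent Nnormal Srepr RS RN.
  split=> //; split=> //; apply/(rota_baxter_commute RM Ridem).
  exact: (representative_commute Nnormal Nab Srepr Ssub RS RN).
have RR g : R (R g) = R g by exact: Ridem.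
split.
- split; first exact: kernel_normal.
  apply/abelian_quotientP; first exact: kernel_normal.
  move=> a b; rewrite !coset_kernelE // !RM.
  by have /(rota_baxter_commute RM Ridem)-> := RB.
- exact: range_subgroup.
(* The representative of the coset of [g] is [R g]. If [R t] lies in the same fibre, then
   idempotence gives [R t = R (R t) = R g]. *)
- move=> _ [g _ <-]; rewrite coset_kernelE //; exists (R g).
  split=> [|s [[t _ <-] /= <-]]; last by rewrite RR.
  by split; [exists g | exact: RR].
- by move=> g; rewrite coset_kernelE //; exact: RR.
Qed.
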